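(* Let $\sigma\in\mathcal{W}_0$ with associated weight matrix $\mathcal{M}_\sigma=\{\mathbf{S}^{(\ell)}:\ell>0\}$, let $\alpha>0$, and set $\mathcal{M}_\sigma\cdot\mathbf{G}^\alpha:=\{\mathbf{S}^{(\ell)}\cdot\mathbf{G}^\alpha:\ell>0\}$. Then, as locally convex vector spaces, for all $\ell>0$: $$\mathfrak{F}_{[\mathcal{M}_\sigma\cdot\mathbf{G}^\alpha]}=\mathfrak{F}_{[\omega_{\mathbf{S}^{(\ell)}\cdot\mathbf{G}^\alpha}]}=\mathfrak{F}_{[\omega_{\mathbf{S}^{(\ell)}}\check{\star}\,\omega_{\mathbf{G}^\alpha}]}=\mathfrak{F}_{[\sigma\check{\star}\,\omega_{\mathbf{G}^\alpha}]}=\mathfrak{F}_{[\sigma\check{\star}\,\mathrm{id}^{1/\alpha}]}=\mathfrak{F}_{[(((\sigma^\iota)^\alpha)_\star)^{1/\alpha}]}$$ for every $\mathfrak{F}\in\{\mathcal{E},\mathcal{B},\mathcal{A},\mathcal{S},\Lambda,\mathcal{F}\}$, in both the Roumieu case $[\cdot]=\{\cdot\}$ and the Beurling case $[\cdot]=(\cdot)$.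
   Context: $\mathbb{N}=\{0,1,2,\dots\}$. Weight functions. $\mathcal{W}_0$ is the set of all continuous, non-decreasing $\omega:[0,+\infty)\to[0,+\infty)$ with $\omega(t)=0$ for $t\in[0,1]$, $\lim_{t\to+\infty}\omega(t)=+\infty$, $\log t=o(\omega(t))$ as $t\to+\infty$, and $\varphi_\omega:t\mapsto\omega(e^t)$ convex on $\mathbb{R}$. Associated weight matrix. For $\omega\in\mathcal{W}_0$: $\varphi^*_\omega(x):=\sup_{y\ge0}\{xy-\varphi_\omega(y)\}$, $x\ge0$, and $\mathcal{M}_\omega:=\{\mathbf{W}^{(\ell)}:\ell>0\}$ with $W^{(\ell)}_p:=\exp(\frac1\ell\varphi^*_\omega(\ell p))$, $p\in\mathbb{N}$. Associated weight function. For a positive sequence $\mathbf{M}$ with $M_0=1$: $\omega_{\mathbf{M}}(t):=\sup_{p\in\mathbb{N}}\log(t^p/M_p)$, $t\ge0$ (with $0^0:=1$). $\mathbf{M}\cdot\mathbf{N}:=(M_pN_p)_p$; $\mathbf{G}^\alpha:=(p!^\alpha)_{p\in\mathbb{N}}$. Conjugates. $\sigma\check{\star}\tau(t):=\inf_{s>0}\{\sigma(s)+\tau(t/s)\}$, $t\ge0$; $\mathrm{id}^{1/\alpha}(t):=t^{1/\alpha}$. For a function $h$: $h^\iota(t):=h(1/t)$ ($t>0$), $h^{\beta}(t):=h(t^{\beta})$ for $\beta>0$ (power substitution), and $h_\star(t):=\inf_{u>0}\{h(u)+tu\}$. Thus $(((\sigma^\iota)^\alpha)_\star)^{1/\alpha}(t)=\inf_{u>0}\{\sigma(u^{-\alpha})+t^{1/\alpha}u\}$.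 Weighted spaces. For a positive sequence $a=(a_p)_p$ consider the following (semi-)norms: $\mathcal{E}$: for $f\in C^\infty(U)$, $U\subseteq\mathbb{R}^d$ non-empty open, $K\subset U$ compact: $\sup_{x\in K,\beta\in\mathbb{N}^d}|\partial^\beta f(x)|/a_{|\beta|}$; $\mathcal{B}$: for $f\in C^\infty(U)$: $\sup_{x\in U,\beta\in\mathbb{N}^d}|\partial^\beta f(x)|/a_{|\beta|}$; $\mathcal{A}$: for $f$ holomorphic on an unbounded sector $S$ (of the Riemann surface of the logarithm): $\sup_{z\in S,p\in\mathbb{N}}|f^{(p)}(z)|/a_p$; $\mathcal{S}$: for $f\in C^\infty(\mathbb{R})$: $\sup_{x\in\mathbb{R},j,k\in\mathbb{N}}(1+|x|)^k|f^{(j)}(x)|/a_{j+k}$; $\Lambda$: for complex sequences $(c_p)_p$: $\sup_p|c_p|/a_p$; $\mathcal{F}$: for formal power series $\sum_pc_px^p$ with complex coefficients: $\sup_p|c_p|/a_p$. For a family $\mathcal{M}=\{\mathbf{M}^{(\ell)}:\ell>0\}$: $\mathfrak{F}_{(\mathcal{M})}$ consists of the elements for which these quantities are finite with $a=(h^pM^{(\ell)}_p)_p$ for all $\ell,h>0$ (and all $K$ if $\mathfrak{F}=\mathcal{E}$), with the topology generated by them; $\mathfrak{F}_{\{\mathcal{M}\}}$ requires finiteness for some $\ell,h>0$ (for $\mathcal{E}$: for every $K$ there exist $\ell,h>0$), with the inductive limit topology over $(\ell,h)$ (for $\mathcal{E}$: projective limit over $K$ of inductive limits). For a non-decreasing $\omega:[0,+\infty)\to[0,+\infty)$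 with $\log t=o(\omega(t))$, $\mathfrak{F}_{(\omega)}$ and $\mathfrak{F}_{\{\omega\}}$ are defined in the same way with $a=\mathbf{W}^{(\ell)}$, $\ell>0$, and no factor $h^p$, where $W^{(\ell)}_p=\exp(\frac1\ell\varphi^*_\omega(\ell p))$ and, if $\omega$ is not zero on $[0,1]$, $\varphi^*_\omega(x):=\sup_{y\in\mathbb{R}}\{xy-\omega(e^y)\}$ (for $\omega\in\mathcal{W}_0$ both suprema agree). $[\cdot]$ denotes either $\{\cdot\}$ or $(\cdot)$, the same choice throughout a formula. *)

(* Defs.v *)
From HB Require Import structures.
From mathcomp Require Import all_boot all_order all_algebra.
From mathcomp Require Import complex.
From mathcomp Require Import all_classical all_reals all_analysis.

Set Implicit Arguments.
Unset Strict Implicit.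
Unset Printing Implicit Defensive.

Import Order.TTheory GRing.Theory Num.Theory.
Import numFieldNormedType.Exports.

Local Open Scope classical_set_scope.
Local Open Scope ring_scope.
Local Open Scope complex_scope.

Section Weights.
Context {R : realType}.
Implicit Types (w h sigma tau : R -> R) (M N : nat -> R).

(* A function on [0, +oo[ is represented by a total function on R; only its
   values on [0, +oo[ are ever used. *)
Record W0 w : Prop := {
  W0_ge0 : forall t, 0 <= t -> 0 <= w t ;
  W0_continuous : {within `[0, +oo[, continuous w} ;
  W0_nondecreasing : {in `[0, +oo[ &, {homo w : s t / s <= t}} ;
  W0_zero : forall t, 0 <= t <= 1 -> w t = 0 ;
  W0_unbounded : w t @[t --> +oo] --> +oo ;
  W0_log : forall e : R, 0 < e -> \forall t \near +oo, `|ln t| <= e * `|w t| ;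
  W0_convex : convex_function [set: R^o] (fun t : R^o => w (expR t)) }.

(* The conjugate of y |-> w (exp y); the supremum is over y >= 0 if w vanishes
   on [0, 1], and over all real y otherwise.  It is finite for x >= 0 as soon
   as w >= 0 and log t = o(w(t)). *)
Definition phi_star w (x : R) : R :=
  sup [set x * y - w (expR y) | y in
    if `[< forall t, 0 <= t <= 1 -> w t = 0 >] then [set y | 0 <= y]
    else [set: R]].

Definition weight_matrix w (l : R) (p : nat) : R :=
  expR (l^-1 * phi_star w (l * p%:R)).

(* [lne] is the logarithm with value -oo at 0, so that for t = 0 only p = 0
   contributes.  The supremum is finite when M_p^(1/p) tends to +oo. *)
Definition assoc_weight M (t : R) : R :=
  fine (ereal_sup [set lne (t ^+ p / M p)%:E | p in [set: nat]]).

Definition seq_mul M N (p : nat) : R := M p * N p.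

Definition gevrey (a : R) (p : nat) : R := (p`!)%:R `^ a.

Definition inf_conv sigma tau (t : R) : R :=
  inf [set sigma s + tau (t / s) | s in [set s | 0 < s]].

Definition invsub h (t : R) : R := h t^-1.

Definition powsub h (b : R) (t : R) : R := h (t `^ b).

Definition lower_conj h (t : R) : R :=
  inf [set h u + t * u | u in [set u | 0 < u]].

End Weights.

Section LocallyConvex.
Context {R : realType} {V : lmodType R[i]}.

Record lcs := Lcs { carrier : set V ; opens : set (set V) }.

Definition seminormed (D : set V) (p : V -> \bar R) : lcs :=
  let E := [set f | D f /\ (p f < +oo)%E] in
  Lcs E [set W | W `<=` E /\ forall f, W f ->
    exists2 e : R, 0 < e & forall g, E g -> (p (g - f)%R < e%:E)%E -> W g].

(* Intersection of the spaces, with the initial topology of the inclusions. *)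
Definition projlim (I : Type) (F : I -> lcs) : lcs :=
  let E := \bigcap_i carrier (F i) in
  Lcs E [set W | W `<=` E /\ forall f, W f ->
    exists (s : set I) (O : I -> set V), [/\ finite_set s,
      forall i, s i -> opens (F i) (O i) /\ O i f &
      forall g, E g -> (forall i, s i -> O i g) -> W g]].

Definition absolutely_convex (A : set V) : Prop :=
  forall (f g : V) (a b : R[i]), A f -> A g ->
    Normc.normc a + Normc.normc b <= 1 -> A (a *: f + b *: g).

(* Union of a directed family of spaces, with the finest locally convex topology
   that makes the inclusions continuous: the absolutely convex sets that meet
   every F i in a neighbourhood of 0 form a base of neighbourhoods of 0. *)
Definition indlim (I : Type) (F : I -> lcs) : lcs :=
  let E := \bigcup_i carrier (F i) in
  Lcs E [set W | W `<=` E /\ forall f, W f ->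
    exists A : set V, [/\ A `<=` E, absolutely_convex A,
      forall i, exists O : set V, [/\ opens (F i) O, O 0 & O `<=` A] &
      forall g, A g -> W (f + g)]].

End LocallyConvex.
Arguments lcs {R} V.

Section Derivatives.
Context {R : realType}.

Section Real.
Context {V : normedModType R}.
Implicit Type f : V -> R[i].

Definition cderive (v : V) f (x : V) : R[i] :=
  'D_v (fun y => complex.Re (f y) : R^o) x
    +i* 'D_v (fun y => complex.Im (f y) : R^o) x.

Definition cderivable (v : V) f (x : V) : Prop :=
  derivable (fun y => complex.Re (f y) : R^o) x v /\
  derivable (fun y => complex.Im (f y) : R^o) x v.

Definition ccontinuous f (x : V) : Prop :=
  {for x, continuous (fun y => complex.Re (f y) : R^o)} /\
  {for x, continuous (fun y => complex.Im (f y) : R^o)}.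

End Real.

Section Partial.
Context {d : nat}.

Definition pderive (i : 'I_d) (f : 'rV[R]_d -> R[i]) : 'rV[R]_d -> R[i] :=
  cderive (delta_mx 0 i) f.

Definition mderive (b : 'I_d -> nat) (f : 'rV[R]_d -> R[i]) :
    'rV[R]_d -> R[i] :=
  foldr (fun i g => iter (b i) (pderive i) g) f (enum 'I_d).

(* f represents a function on U: it is extended by 0 outside U.  Its iterated
   partial derivatives, in any order, exist and are continuous on U. *)
Definition smooth_on (U : set 'rV[R]_d) (f : 'rV[R]_d -> R[i]) : Prop :=
  (forall x, ~ U x -> f x = 0) /\
  forall (s : seq 'I_d) (x : 'rV[R]_d), U x ->
    ccontinuous (foldr pderive f s) x /\
    forall i, cderivable (delta_mx 0 i) (foldr pderive f s) x.

End Partial.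

Definition smooth_line (f : R -> R[i]) : Prop :=
  forall (j : nat) (x : R),
    cderivable (1 : R^o) (iter j (cderive (1 : R^o)) f) x.

(* Points of the Riemann surface of the logarithm are pairs (modulus, argument)
   with positive modulus and arbitrary real argument; [surface_proj] is the
   local homeomorphism to the punctured plane, and complex derivatives are
   taken with respect to it. *)
Definition surface_proj (z : R * R) : R[i] :=
  (z.1 * cos z.2) +i* (z.1 * sin z.2).

Definition sector (a b : R) : set (R * R) :=
  [set z | 0 < z.1 /\ a < z.2 < b].

Definition diff_quot (f : R * R -> R[i]) (z w : R * R) : R[i]^o :=
  (f w - f z) / (surface_proj w - surface_proj z).

Definition sderive (f : R * R -> R[i]) (z : R * R) : R[i] :=
  lim (diff_quot f z w @[w --> z^']).

(* As for [smooth_on], f is extended by 0 outside S. *)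
Definition holomorphic_on (S : set (R * R)) (f : R * R -> R[i]) : Prop :=
  (forall z, ~ S z -> f z = 0) /\
  forall z, S z -> cvg (diff_quot f z w @[w --> z^']).

End Derivatives.

Section WeightedSpaces.
Context {R : realType}.
Implicit Type a : nat -> R.

Definition normE d (K : set 'rV[R]_d) a (f : 'rV[R]_d -> R[i]) : \bar R :=
  ereal_sup [set (Normc.normc (mderive b f x) / a (\sum_i b i)%N)%:E |
    x in K & b in [set: 'I_d -> nat]].

Definition normA (S : set (R * R)) a (f : R * R -> R[i]) : \bar R :=
  ereal_sup [set (Normc.normc (iter p sderive f z) / a p)%:E |
    z in S & p in [set: nat]].

Definition normS a (f : R -> R[i]) : \bar R :=
  ereal_sup [set ((1 + `|x|) ^+ jk.2
      * Normc.normc (iter jk.1 (cderive (1 : R^o)) f x)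
      / a (jk.1 + jk.2)%N)%:E |
    x in [set: R] & jk in [set: nat * nat]].

Definition normL a (c : nat -> R[i]) : \bar R :=
  ereal_sup [set (Normc.normc (c p) / a p)%:E | p in [set: nat]].

(* The objects are the elements of [dom]; every positive sequence defines a
   family of semi-norms on them, indexed by [seminorm_index] (the compact
   subsets of U for E, a single index otherwise). *)
Record setting := Setting {
  ambient : lmodType R[i] ;
  dom : set ambient ;
  seminorm_index : Type ;
  snorm : seminorm_index -> (nat -> R) -> ambient -> \bar R }.

(* [SpF]: a formal power series is the sequence of its coefficients. *)
Inductive object_class :=
| SpE (d : nat) (U : set 'rV[R]_d) of open U & U !=set0
| SpB (d : nat) (U : set 'rV[R]_d) of open U & U !=set0
| SpA (a b : R) of a < b
| SpS
| SpLambda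
| SpF.

Definition setting_of (F : object_class) : setting :=
  match F with
  | SpE d U _ _ =>
      @Setting ('rV[R]_d -> R[i]^o) (smooth_on U)
        {K : set 'rV[R]_d | compact K /\ K `<=` U}
        (fun K => normE (proj1_sig K))
  | SpB d U _ _ =>
      @Setting ('rV[R]_d -> R[i]^o) (smooth_on U) unit (fun=> normE U)
  | SpA a b _ =>
      @Setting (R * R -> R[i]^o) (holomorphic_on (sector a b)) unit
        (fun=> normA (sector a b))
  | SpS => @Setting (R -> R[i]^o) smooth_line unit (fun=> normS)
  | SpLambda => @Setting (nat -> R[i]^o) setT unit (fun=> normL)
  | SpF => @Setting (nat -> R[i]^o) setT unit (fun=> normL)
  end.

Inductive bracket := Roumieu | Beurling.

Definition weighted (F : object_class) (br : bracket) (J : Type)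
    (A : J -> nat -> R) : lcs (ambient (setting_of F)) :=
  let X := setting_of F in
  match br with
  | Roumieu => projlim (fun k : seminorm_index X => indlim (fun j : J =>
      seminormed (@dom X) (@snorm X k (A j))))
  | Beurling => projlim (fun kj : seminorm_index X * J =>
      seminormed (@dom X) (@snorm X kj.1 (A kj.2)))
  end.

Definition space_matrix (F : object_class) (br : bracket) (M : R -> nat -> R) :=
  weighted F br (fun (lh : {posnum R} * {posnum R}) p =>
    lh.2%:num ^+ p * M lh.1%:num p).

Definition space_function (F : object_class) (br : bracket) (w : R -> R) :=
  weighted F br (fun l : {posnum R} => weight_matrix w l%:num).

End WeightedSpaces.
Arguments object_class R : clear implicits.
Arguments setting R : clear implicits.

(* Main.v *)
(** In logarithmic variables everything is Young conjugation.  With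
    [phi w y = w (e^y)], infimal convolution of weights is infimal convolution
    of the functions [phi w], so [phi_star] turns it into a sum and the weight
    matrix of [inf_conv sigma (t^(1/alpha))] is exactly the product of the
    weight matrices of [sigma] and of [t^(1/alpha)]; the latter is
    [p!^alpha] up to geometric factors [h^p], where every [h] is reached by
    varying the parameter.  This identifies the matrix space.  The other weight
    functions are equivalent up to affine rescaling, which changes neither kind
    of space: [omega_{G^alpha}] to [t^(1/alpha)] by Stirling-type bounds;
    [omega_{S^(l)}] to [sigma] by rounding the slope of a supporting line of the
    convex function [phi sigma] down to a multiple of [l], the error [l log t]
    being absorbed because [log t = o(sigma)]; and
    [omega_{M N} = inf_conv omega_M omega_N] for log-convex [M] and [N], because
    an index maximal for [M N] at [t] is maximal for [M] at [s] and for [N] at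
    [t / s], for some [s]. *)
Require Import Defs.
From mathcomp Require Import all_boot all_order all_algebra.
From mathcomp Require Import complex lra ring.
From mathcomp Require Import all_classical all_reals all_analysis.

Import Order.TTheory GRing.Theory Num.Theory.
Import numFieldNormedType.Exports.
Local Open Scope classical_set_scope.
Local Open Scope ring_scope.

(** * Comparison of seminormed spaces and of their projective and inductive limits *)

Section Spaces.
Context {R : realType}.
Set Implicit Arguments.
Unset Strict Implicit.

Definition continuous_incl (V : lmodType R[i]) (X Y : lcs V) : Prop :=
  carrier X `<=` carrier Y /\
  forall O, opens Y O -> opens X (O `&` carrier X).

Lemma seminormed_le (V : lmodType R[i]) (D : set V) (p q : V -> \bar R) (C : R) :
  0 < C -> (forall f, q f <= C%:E * p f)%E ->
  continuous_incl (seminormed D p) (seminormed D q).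
Proof.
move=> C0 qp.
have pq f : (p f < +oo -> q f < +oo)%E.
  move=> pf; apply: le_lt_trans (qp f) _.
  by rewrite lte_mul_pinfty // lee_fin ltW.
split=> [f [Df pf]|O [/= sub nbh]].
  by split => //; apply: pq.
split=> [f []|f [/nbh[e e0 He] Ef]] //.
exists (e / C); first by rewrite divr_gt0.
move=> g [Dg pg] small; split; last by split.
apply: He; first by split => //; exact: pq.
apply: le_lt_trans (qp _) _.
by rewrite -lte_pdivlMl// muleC -EFinM.
Qed.

Lemma seminormedI (V : lmodType R[i]) (D : set V) (p : V -> \bar R) (O1 O2 : set V) :
  opens (seminormed D p) O1 -> opens (seminormed D p) O2 ->
  opens (seminormed D p) (O1 `&` O2).
Proof.
move=> [s1 n1] [s2 n2]; split=> [f [/s1]|f [/n1[e1 e10 H1] /n2[e2 e20 H2]]] //.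
exists (Order.min e1 e2); first by rewrite lt_min e10.
move=> g Eg; rewrite EFin_min lt_min => /andP[g1 g2].
by split; [apply: H1|apply: H2].
Qed.

Lemma seminormed_carrier_open (V : lmodType R[i]) (D : set V) (p : V -> \bar R) :
  opens (seminormed D p) (carrier (seminormed D p)).
Proof. by split=> // f _; exists 1. Qed.

(** The maps from [F] to [G] serve only the carriers. A neighbourhood of 0 for [F] is one for [G]
    because its trace on each [G j] is pulled back from some [F i]. *)
Lemma indlim_le (V : lmodType R[i]) (I J : Type) (F : I -> lcs V) (G : J -> lcs V) :
  (forall j, carrier (G j) 0) ->
  (forall i, exists j, continuous_incl (F i) (G j)) ->
  (forall j, exists i, continuous_incl (G j) (F i)) ->
  carrier (indlim F) `<=` carrier (indlim G) /\
  opens (indlim F) `<=` opens (indlim G).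
Proof.
move=> G0 FG GF.
have EF : carrier (indlim F) `<=` carrier (indlim G).
  by move=> f [i _ Ff]; have [j [sub _]] := FG i; exists j => //; exact: sub.
split=> [|W [/= WF nbh]]; first exact: EF.
split=> [f /WF Ff|f Wf]; first exact: EF.
have [A [AE cA inA AW]] := nbh f Wf.
exists A; split => // [g /AE/EF//|j].
have [i [ji oji]] := GF j; have [B [oB B0 BA]] := inA i.
exists (B `&` carrier (G j)); split => //; first exact: oji.
by move=> g [/BA].
Qed.

Lemma indlim_eq (V : lmodType R[i]) (I J : Type) (F : I -> lcs V) (G : J -> lcs V) :
  (forall i, carrier (F i) 0) -> (forall j, carrier (G j) 0) ->
  (forall i, exists j, continuous_incl (F i) (G j)) ->
  (forall j, exists i, continuous_incl (G j) (F i)) ->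
  indlim F = indlim G.
Proof.
move=> F0 G0 FG GF.
have [cFG oFG] := indlim_le G0 FG GF.
have [cGF oGF] := indlim_le F0 GF FG.
have : carrier (indlim F) = carrier (indlim G) by apply/seteqP.
have : opens (indlim F) = opens (indlim G) by apply/seteqP.
by case: (indlim F) (indlim G) => ? ? [? ?] /= -> ->.
Qed.

(** A condition on [G j] is pulled back to one on some [F i]. The topological half assumes the
    reverse inclusion of carriers because open sets must lie in the carrier. *)
Lemma projlim_le (V : lmodType R[i]) (I J : Type) (F : I -> lcs V) (G : J -> lcs V) :
  (forall i, opens (F i) (carrier (F i))) ->
  (forall i O1 O2, opens (F i) O1 -> opens (F i) O2 -> opens (F i) (O1 `&` O2)) ->
  (forall j, exists i, continuous_incl (F i) (G j)) ->
  carrier (projlim F) `<=` carrier (projlim G) /\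
  (carrier (projlim G) `<=` carrier (projlim F) ->
   opens (projlim G) `<=` opens (projlim F)).
Proof.
move=> FT FI FG.
have EF : carrier (projlim F) `<=` carrier (projlim G).
  by move=> f /= Ff j _; have [i [sub _]] := FG j; apply: sub; exact: Ff.
split=> [|EG W [/= WG nbh]]; first exact: EF.
split=> [f /WG Gf|f Wf]; first exact: EG.
have [s [ O [fs sO OW]]] := nbh f Wf.
have [m mP] := choice FG.
(* Several indices j may be sent to the same i, so [O' i] collects all their conditions; it is open
   by induction on a list enumerating [s]. *)
pose O' i := [set g | carrier (F i) g /\ forall j, s j -> m j = i -> O j g].
exists (m @` s), O'; split; first exact: finite_image.
- move=> _ [j sj <-]; have Ff : carrier (projlim F) f by apply: EG; exact: WG.
  split; last by split=> [|k /sO[]//]; exact: Ff.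
  move: (m j) => i {j sj}.
  have [t st] : exists t : seq {classic J}, s = [set` t] by exact/finite_seqP.
  have O't : forall j, j \in t -> opens (G j) (O j).
    by move=> j jt; have [] := sO j; rewrite // st.
  rewrite (_ : O' i = [set g | carrier (F i) g /\
      forall j, j \in t -> m j = i -> O j g]); last by rewrite /O' st.
  elim: t O't {st} => [|k t IH] O't.
    rewrite (_ : mkset _ = carrier (F i)); first exact: FT.
    by apply/seteqP; split=> [g []|g].
  have oIH : opens (F i) [set g | carrier (F i) g /\
      forall j, j \in t -> m j = i -> O j g].
    by apply: IH => j jt; apply: O't; rewrite inE jt orbT.
  have [mk|mk] := pselect (m k = i); last first.
    rewrite (_ : mkset _ = [set g | carrier (F i) g /\
        forall j, j \in t -> m j = i -> O j g]) //.
    apply/seteqP; split=> g [Fg Og]; split=> // j jt; first by apply: Og; rewrite inE jt orbT.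
    by move: jt; rewrite inE => /orP[/eqP->/mk|/Og].
  have [_ inckO] := mP k.
  have okO : opens (F i) (O k `&` carrier (F i)).
    by rewrite -mk; apply: inckO; apply: O't; rewrite inE eqxx.
  rewrite (_ : mkset _ = (O k `&` carrier (F i)) `&` [set g | carrier (F i) g /\
        forall j, j \in t -> m j = i -> O j g]); first exact: FI.
  apply/seteqP; split=> g.
    move=> [Fg Og]; split; last by split => // j jt; apply: Og; rewrite inE jt orbT.
    by split=> //; apply: Og; rewrite // inE eqxx.
  move=> [[Okg Fg] [_ Og]]; split=> // j; rewrite inE => /orP[/eqP->//|]; exact: Og.
- move=> g Fg O'g; apply: OW => [|j sj]; first exact: EF.
  by have [|_ Og] := O'g (m j); [by exists j|exact: Og].
Qed.

Lemma projlim_eq (V : lmodType R[i]) (I J : Type) (F : I -> lcs V) (G : J -> lcs V) :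
  (forall i, opens (F i) (carrier (F i))) ->
  (forall i O1 O2, opens (F i) O1 -> opens (F i) O2 -> opens (F i) (O1 `&` O2)) ->
  (forall j, opens (G j) (carrier (G j))) ->
  (forall j O1 O2, opens (G j) O1 -> opens (G j) O2 -> opens (G j) (O1 `&` O2)) ->
  (forall j, exists i, continuous_incl (F i) (G j)) ->
  (forall i, exists j, continuous_incl (G j) (F i)) ->
  projlim F = projlim G.
Proof.
move=> FT FI GT GI FG GF.
have [cFG oGF] := projlim_le FT FI FG.
have [cGF oFG] := projlim_le GT GI GF.
have : carrier (projlim F) = carrier (projlim G) by apply/seteqP.
have : opens (projlim F) = opens (projlim G).
  by apply/seteqP; split; [exact: oFG|exact: oGF].
by case: (projlim F) (projlim G) => ? ? [? ?] /= -> ->.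
Qed.

(** * The concrete seminorms and their dependence on the weight sequence *)

Lemma normc_ge0 (x : R[i]) : 0 <= Normc.normc x.
Proof. by case: x => a b; rewrite /Normc.normc sqrtr_ge0. Qed.

Lemma cderive0 (V : normedModType R) (v : V) : cderive v (fun=> 0) = fun=> 0.
Proof.
apply/funext => x; rewrite /cderive /= (_ : (fun _ => 0) = cst 0) //.
by rewrite derive_cst.
Qed.

Lemma mderive0 d (b : 'I_d -> nat) : mderive b (fun=> 0) = (fun=> 0 : R[i]).
Proof.
rewrite /mderive; elim: (enum 'I_d) => //= i s ->.
by elim: (b i) => //= n ->; exact: cderive0.
Qed.

(** Moving the modulus by half the radius stays inside the punctured ball. Properness is what gives
    the limit in [sderive] its value on a constant quotient. *)
Lemma dnbhs_prod_proper (z : R * R) : ProperFilter z^'.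
Proof.
apply: Build_ProperFilter_ex => A; rewrite /dnbhs /within /= => /nbhs_ballP[e /= e0 eA].
exists (z.1 + e / 2, z.2); apply: eA.
  split => /=; last exact: ballxx.
  rewrite /ball /= opprD addrA subrr sub0r normrN gtr0_norm ?divr_gt0//.
  by rewrite gtr_pMr// invf_lt1// ltr1n.
apply/eqP => /(congr1 fst)/= /eqP; rewrite -subr_eq0 addrAC subrr add0r.
by rewrite gt_eqF ?divr_gt0.
Qed.

Lemma sderive0 : sderive (fun=> 0) = (fun=> 0 : R[i]).
Proof.
apply/funext => z; rewrite /sderive.
rewrite (_ : diff_quot _ z = cst 0).
  exact (@lim_cst _ (@norm_hausdorff R[i] R[i]^o) _ _ (dnbhs_prod_proper z) 0).
by apply/funext => w; rewrite /diff_quot subr0 mul0r.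
Qed.

Lemma foldr_pderive0 d (s : seq 'I_d) : foldr pderive (fun=> 0) s = (fun=> 0 : R[i]).
Proof. by elim: s => //= i s ->; exact: cderive0. Qed.


(** A common shape for all the seminorms, in which the weight enters only as a divisor; changes of
    weight can then be treated once for every class. *)
Lemma snorm_sup (F : object_class R) (k : seminorm_index (setting_of F)) :
  exists (J : Type) (P : set J) (deg : J -> nat)
      (v : ambient (setting_of F) -> J -> R),
    [/\ forall f j, 0 <= v f j, forall j, v 0 j = 0 &
        forall a f, snorm k a f =
          ereal_sup [set (v f j / a (deg j))%:E | j in P]].
Proof.
have im2 (A B C : Type) (X : set A) (Y : set B) (f : A -> B -> C) :
    [set f x y | x in X & y in Y] = [set f z.1 z.2 | z in X `*` Y].
  by apply/seteqP; split=> [_ [x Xx [y Yy <-]]|_ [[x y] [Xx Yy] <-]];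
    [exists (x, y)|exists x => //; exists y].
case: F k => [d U oU U0|d U oU U0|a b ab|||] k.
- exists ('rV[R]_d * ('I_d -> nat))%type, (sval k `*` setT),
    (fun j => (\sum_i j.2 i)%N), (fun f j => Normc.normc (mderive j.2 f j.1)).
  by split=> [f j|j|a f /=]; rewrite ?normc_ge0 ?mderive0 ?Normc.normc0 // /normE im2.
- exists ('rV[R]_d * ('I_d -> nat))%type, (U `*` setT),
    (fun j => (\sum_i j.2 i)%N), (fun f j => Normc.normc (mderive j.2 f j.1)).
  by split=> [f j|j|a f /=]; rewrite ?normc_ge0 ?mderive0 ?Normc.normc0 // /normE im2.
- exists ((R * R) * nat)%type, (sector a b `*` setT), snd,
    (fun f j => Normc.normc (iter j.2 sderive f j.1)).
  split=> [f j|j|c f /=]; rewrite ?normc_ge0 /normA ?im2 //.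
  rewrite (_ : iter _ _ _ = fun=> 0) ?Normc.normc0 //.
  by elim: j.2 => //= n ->; exact: sderive0.
- exists (R * (nat * nat))%type, (setT `*` setT), (fun j => j.2.1 + j.2.2)%N,
    (fun f j => (1 + `|j.1|) ^+ j.2.2
       * Normc.normc (iter j.2.1 (cderive (1 : R^o)) f j.1)).
  split=> [f j|j|a f /=]; rewrite /normS ?im2 //.
    by rewrite mulr_ge0 ?normc_ge0 ?exprn_ge0 ?addr_ge0.
  rewrite (_ : iter _ _ _ = fun=> 0) ?Normc.normc0 ?mulr0 //.
  by elim: j.2.1 => //= n ->; exact: cderive0.
- exists nat, setT, id, (fun f j => Normc.normc (f j)).
  by split=> [f j|j|a f /=]; rewrite ?normc_ge0 ?Normc.normc0.
- exists nat, setT, id, (fun f j => Normc.normc (f j)).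
  by split=> [f j|j|a f /=]; rewrite ?normc_ge0 ?Normc.normc0.
Qed.

(** Together with [snorm0] this puts 0 in every seminormed step, as [indlim_eq] requires. *)
Lemma dom0 (F : object_class R) : @dom R (setting_of F) 0.
Proof.
have smooth0 d (U : set 'rV[R]_d) : smooth_on U (fun=> 0).
  split=> // s x Ux; rewrite foldr_pderive0; split; first by split; apply: (@cst_continuous _ R^o 0 x).
  by move=> i; split; exact: derivable_cst.
case: F => [d U oU U0|d U oU U0|a b ab|||] //=.
- split=> // z _; rewrite (_ : diff_quot _ z = cst 0); first exact (@is_cvg_cst R[i]^o 0 _ z^' _).
  by apply/funext => w; rewrite /diff_quot subr0 mul0r.
- move=> j x; rewrite (_ : iter _ _ _ = fun=> 0); first by split; exact: derivable_cst.
  by elim: j => //= n ->; exact: cderive0.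
Qed.

Lemma snorm0 (F : object_class R) (k : seminorm_index (setting_of F)) a :
  (snorm k a 0 < +oo)%E.
Proof.
have [J [P [deg [v [_ v0 ->]]]]] := snorm_sup k.
apply: (@le_lt_trans _ _ 0%E); last exact: ltry.
by apply: ge_ereal_sup => _ [j _ <-]; rewrite v0 mul0r.
Qed.

Lemma snorm_le (F : object_class R) (k : seminorm_index (setting_of F))
    (a b : nat -> R) (C : R) :
  (forall p, 0 < a p) -> (forall p, 0 < b p) -> 0 < C ->
  (forall p, a p <= C * b p) ->
  forall f, (snorm k b f <= C%:E * snorm k a f)%E.
Proof.
move=> a0 b0 C0 aCb f; have [J [P [deg [v [v_ge0 _ vE]]]]] := snorm_sup k.
rewrite !vE; apply: ge_ereal_sup => _ [j Pj <-].
apply: (@le_trans _ _ (C%:E * (v f j / a (deg j))%:E)%E).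
  rewrite -EFinM lee_fin mulrCA ler_wpM2l // ler_pdivlMr //.
  by rewrite mulrC ler_pdivrMr.
by apply: lee_wpmul2l; [rewrite lee_fin ltW|apply: ereal_sup_ubound; exists j].
Qed.

(** The weight divides in the seminorms, so this embeds the space of [A j] continuously in that of
    [B j']. *)
Definition dominated (J J' : Type) (A : J -> nat -> R) (B : J' -> nat -> R) j j' :=
  exists2 C : R, 0 < C & forall p, A j p <= C * B j' p.

(* The first two clauses govern the Roumieu spaces, the last two the Beurling
   spaces. *)
Definition equivalent (J J' : Type) (A : J -> nat -> R) (B : J' -> nat -> R) :=
  [/\ forall j, exists j', dominated A B j j',
      forall j', exists j, dominated B A j' j,
      forall j', exists j, dominated A B j j' &
      forall j, exists j', dominated B A j' j].

Lemma weighted_eq (F : object_class R) (br : bracket) (J J' : Type)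
    (A : J -> nat -> R) (B : J' -> nat -> R) :
  (forall j p, 0 < A j p) -> (forall j p, 0 < B j p) -> equivalent A B ->
  weighted F br A = weighted F br B.
Proof.
move=> A0 B0 [AB BA AB' BA'].
have incl (K K' : Type) (X : K -> nat -> R) (Y : K' -> nat -> R) k i j :
    (forall j p, 0 < X j p) -> (forall j p, 0 < Y j p) -> dominated X Y i j ->
    continuous_incl (seminormed (@dom _ (setting_of F)) (snorm k (X i)))
      (seminormed (@dom _ (setting_of F)) (snorm k (Y j))).
  move=> X0 Y0 [C C0 XY].
  exact: (@seminormed_le _ (@dom _ (setting_of F)) (snorm k (X i)) (snorm k (Y j))
    C C0 (snorm_le k (X0 i) (Y0 j) C0 XY)).
have zero (K : Type) (X : K -> nat -> R) k i :
    carrier (seminormed (@dom _ (setting_of F)) (snorm k (X i))) 0.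
  by split; [exact: dom0|exact: snorm0].
case: br.
- rewrite /weighted; congr projlim; apply/funext => k.
  apply: indlim_eq => // [i|j]; [have [j ij] := AB i|have [i ij] := BA j].
  + by exists j; exact: incl.
  + by exists i; exact: incl.
- apply: projlim_eq => [?|???|?|???|[k j]|[k i]].
  + exact: seminormed_carrier_open.
  + exact: seminormedI.
  + exact: seminormed_carrier_open.
  + exact: seminormedI.
  + by have [i ij] := AB' j; exists (k, i); exact: incl.
  + by have [j ij] := BA' i; exists (k, j); exact: incl.
Qed.

End Spaces.

(** * Young conjugation, weight matrices and infimal convolution *)

Section Conjugate.
Context {R : realType}.
Set Implicit Arguments.
Unset Strict Implicit.
Implicit Types (w sigma tau : R -> R) (x y z : R).

(** What conjugation needs: nonnegativity and a finite conjugate on [0, +oo[. Only positive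
    arguments are involved, so the value at 0 is left free. *)
Definition weight_function w : Prop :=
  (forall y, 0 <= w (expR y)) /\
  forall x, 0 <= x -> exists B, forall y, x * y - w (expR y) <= B.

Lemma phi_star_has_sup w x : weight_function w -> 0 <= x ->
  has_sup [set x * y - w (expR y) | y in
    if `[< forall t, 0 <= t <= 1 -> w t = 0 >] then [set y | 0 <= y]
    else [set: R]].
Proof.
move=> [_ wb] /wb[B xB]; split.
  by case: ifP => _; exists (x * 0 - w (expR 0)), 0 => /=.
by exists B => _ [y _ <-].
Qed.

(** Valid for all real y in both branches of [phi_star]: if w vanishes on [0, 1], a negative y gives
    a value at most 0, which is the value at y = 0. *)
Lemma phi_star_ge w x y : weight_function w -> 0 <= x ->
  x * y - w (expR y) <= phi_star w x.
Proof.
move=> ww x0; have [_ ub] := phi_star_has_sup ww x0.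
rewrite /phi_star; move: ub; case: ifP => [/asboolP w0|_] ub; last first.
  by apply: ub_le_sup => //; exists y.
have [y0|/ltW y0] := leP 0 y; first by apply: ub_le_sup => //; exists y.
apply: (@le_trans _ _ (x * 0 - w (expR 0))); last first.
  by apply: ub_le_sup => //; exists 0 => /=.
rewrite mulr0 expR0 (w0 1) ?ler01 ?lexx// lerB ?mulr_ge0_le0 //.
by case: ww => ->.
Qed.

Lemma phi_star_le w x B : weight_function w -> 0 <= x ->
  (forall y, x * y - w (expR y) <= B) -> phi_star w x <= B.
Proof.
move=> ww x0 xB; apply: ge_sup; first by have [] := phi_star_has_sup ww x0.
by move=> _ [y _ <-].
Qed.

(** With the next lemma, the logarithm of the matrix entry is the supremum over real y of p y -
    w(e^y) / l, the form used in most later estimates. *)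
Lemma ln_weight_matrix_ge w l y p : weight_function w -> 0 < l ->
  p%:R * y - w (expR y) / l <= ln (weight_matrix w l p).
Proof.
move=> ww l0; rewrite /weight_matrix expRK [leRHS]mulrC ler_pdivlMr// mulrBl divfK ?gt_eqF//.
by rewrite mulrAC [_ * l]mulrC; apply: phi_star_ge => //; rewrite mulr_ge0// ltW.
Qed.

Lemma ln_weight_matrix_le w l p B : weight_function w -> 0 < l ->
  (forall y, p%:R * y - w (expR y) / l <= B) -> ln (weight_matrix w l p) <= B.
Proof.
move=> ww l0 pB; rewrite /weight_matrix expRK [leLHS]mulrC ler_pdivrMr//.
apply: phi_star_le => // [|y]; first by rewrite mulr_ge0// ltW.
have /(ler_wpM2l (ltW l0)) := pB y.
by rewrite mulrBr mulrA [l * (_ / l)]mulrC divfK ?gt_eqF// [B * l]mulrC.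
Qed.

Lemma weight_matrix_gt0 w l p : 0 < weight_matrix w l p.
Proof. exact: expR_gt0. Qed.

Lemma weight_matrix_mono w k l p : weight_function w -> 0 < k -> k <= l ->
  weight_matrix w k p <= weight_matrix w l p.
Proof.
move=> ww k0 kl; have l0 := lt_le_trans k0 kl.
rewrite -ler_ln ?posrE ?weight_matrix_gt0//.
apply: ln_weight_matrix_le => // y; apply: le_trans (ln_weight_matrix_ge y p ww l0).
by rewrite lerB// ler_wpM2l ?lef_pV2 ?posrE//; case: ww => ->.
Qed.

Definition wle w1 w2 : Prop :=
  exists C D, 0 < C /\ forall y, w1 (expR y) <= C * w2 (expR y) + D.

Lemma wle_weight_function w1 w2 : wle w1 w2 -> weight_function w1 ->
  (forall y, 0 <= w2 (expR y)) -> weight_function w2.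
Proof.
move=> [C [D [C0 le12]]] [_ w1b] w2_ge0; split=> // x x0.
have [|B CxB] := w1b (C * x); first by rewrite mulr_ge0// ltW.
exists ((B + D) / C) => y; rewrite ler_pdivlMr//.
have := CxB y; have := le12 y; lra.
Qed.

(** Conjugation reverses the order: from w1 <= c w2 + D follows (w1 - D) / (l c) <= w2 / l, so c
    moves into the parameter and D becomes the factor e^(D / (l c)). *)
Lemma wle_dominated w1 w2 : weight_function w1 -> weight_function w2 -> wle w1 w2 ->
  exists2 c, 0 < c & forall l, 0 < l ->
    exists2 C, 0 < C & forall p, weight_matrix w2 l p <= C * weight_matrix w1 (l * c) p.
Proof.
move=> ww1 ww2 [c [D [c0 le12]]]; exists c => // l l0.
exists (expR (D / (l * c))) => [|p]; first exact: expR_gt0.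
rewrite -ler_ln ?posrE ?mulr_gt0 ?expR_gt0// lnM ?posrE ?expR_gt0// expRK.
apply: ln_weight_matrix_le => // y.
have lc0 : 0 < l * c by rewrite mulr_gt0.
have := ln_weight_matrix_ge y p ww1 lc0.
have : (w1 (expR y) - D) / (l * c) <= w2 (expR y) / l.
  rewrite ler_pdivrMr// mulrA divfK ?gt_eqF// lerBlDr mulrC; exact: le12.
rewrite mulrBl; lra.
Qed.

Lemma wle_space_function F br w1 w2 : weight_function w1 -> weight_function w2 ->
  wle w1 w2 -> wle w2 w1 -> space_function F br w1 = space_function F br w2.
Proof.
move=> ww1 ww2 le12 le21.
have [c c0 dom21] := wle_dominated ww1 ww2 le12.
have [c' c'0 dom12] := wle_dominated ww2 ww1 le21.
apply: weighted_eq => [j p|j p|]; [exact: weight_matrix_gt0|exact: weight_matrix_gt0|].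
split=> j.
- by exists (PosNum (mulr_gt0 [gt0 of j%:num] c'0)); exact: dom12.
- by exists (PosNum (mulr_gt0 [gt0 of j%:num] c0)); exact: dom21.
(* In the Beurling clauses the target parameter is prescribed, so the source parameter is divided by
   the constant. *)
- exists (PosNum (divr_gt0 [gt0 of j%:num] c'0)).
  have [C C0 /=] := dom12 _ (divr_gt0 [gt0 of j%:num] c'0).
  by rewrite divfK ?gt_eqF//; exists C.
- exists (PosNum (divr_gt0 [gt0 of j%:num] c0)).
  have [C C0 /=] := dom21 _ (divr_gt0 [gt0 of j%:num] c0).
  by rewrite divfK ?gt_eqF//; exists C.
Qed.

(** In logarithmic variables s = e^a and t / s = e^(y - a). Nonnegativity bounds the set below, so
    that [inf] is a genuine infimum. *)
Lemma inf_conv_le sigma tau y a :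
  (forall z, 0 <= sigma (expR z)) -> (forall z, 0 <= tau (expR z)) ->
  inf_conv sigma tau (expR y) <= sigma (expR a) + tau (expR (y - a)).
Proof.
move=> s0 t0; apply: ge_inf; last first.
  by exists (expR a); [exact: expR_gt0|rewrite expRB].
exists 0 => _ [s /= s_gt0 <-].
by rewrite -(lnK s_gt0) -expRB addr_ge0.
Qed.

Lemma inf_conv_ge sigma tau y B :
  (forall a, B <= sigma (expR a) + tau (expR (y - a))) ->
  B <= inf_conv sigma tau (expR y).
Proof.
move=> HB; apply: lb_le_inf.
  by exists (sigma 1 + tau (expR y / 1)), 1 => //=.
by move=> _ [s /= s0 <-]; have := HB (ln s); rewrite expRB lnK.
Qed.

Lemma phi_star_inf_conv_ge sigma tau x y :
  weight_function sigma -> weight_function tau -> 0 <= x ->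
  x * y - inf_conv sigma tau (expR y) <= phi_star sigma x + phi_star tau x.
Proof.
move=> ws wt x0; rewrite lerBlDr -lerBlDl; apply: inf_conv_ge => a.
have := phi_star_ge a ws x0; have := phi_star_ge (y - a) wt x0; lra.
Qed.

Lemma inf_conv_weight_function sigma tau :
  weight_function sigma -> weight_function tau ->
  weight_function (inf_conv sigma tau).
Proof.
move=> ws wt; split=> [y|x x0]; last first.
  by exists (phi_star sigma x + phi_star tau x) => y; exact: phi_star_inf_conv_ge.
by apply: inf_conv_ge => a; rewrite addr_ge0 //; [case: ws => ->|case: wt => ->].
Qed.

(** The suprema over independent a and b on the right merge into one over y = a + b on the left. *)
Lemma phi_star_inf_conv sigma tau x :
  weight_function sigma -> weight_function tau -> 0 <= x ->
  phi_star (inf_conv sigma tau) x = phi_star sigma x + phi_star tau x.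
Proof.
move=> ws wt x0; have w := inf_conv_weight_function ws wt.
apply/le_anti/andP; split.
  by apply: phi_star_le => // y; exact: phi_star_inf_conv_ge.
rewrite -lerBrDr; apply: phi_star_le => // a; rewrite lerBrDl -lerBrDr.
apply: phi_star_le => // b; have := phi_star_ge (a + b) w x0.
have [[s0 _] [t0 _]] := (ws, wt).
have := @inf_conv_le sigma tau (a + b) a s0 t0; rewrite [a + b - a]addrAC subrr add0r.
lra.
Qed.

Lemma inf_conv_wle s1 s2 t1 t2 :
  (forall z, 0 <= s1 (expR z)) -> (forall z, 0 <= t1 (expR z)) ->
  (forall z, 0 <= s2 (expR z)) -> (forall z, 0 <= t2 (expR z)) ->
  wle s1 s2 -> wle t1 t2 -> wle (inf_conv s1 t1) (inf_conv s2 t2).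
Proof.
move=> s10 t10 s20 t20 [C [D [C0 le12]]] [C' [D' [C'0 le12']]].
(* A common factor for both summands; the extra terms C t2 and C' s2 are nonnegative. *)
exists (C + C'), (D + D'); split; first by rewrite addr_gt0.
move=> y; rewrite -lerBlDr mulrC -ler_pdivrMr ?addr_gt0//.
apply: inf_conv_ge => a; rewrite ler_pdivrMr ?addr_gt0//.
have := inf_conv_le y a s10 t10; have := le12 a; have := le12' (y - a).
have := mulr_ge0 (ltW C0) (t20 (y - a)); have := mulr_ge0 (ltW C'0) (s20 a); lra.
Qed.

End Conjugate.

(** * Growth and supporting lines of weights, associated weight functions, Gevrey sequences *)

Section Growth.
Context {R : realType}.
Set Implicit Arguments.
Unset Strict Implicit.
Implicit Types (w sigma tau : R -> R) (x y z alpha : R).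

Lemma W0_lnE sigma (e : R) : W0 sigma -> 0 < e ->
  exists B, forall y, y <= e * sigma (expR y) + B.
Proof.
move=> ws e0; have [M [_ HM]] := W0_log ws e0.
have s0 y : 0 <= sigma (expR y) by apply: (W0_ge0 ws); exact: expR_ge0.
(* Up to the threshold M of the little-o estimate, y itself is bounded by this constant. *)
exists (ln (Num.max M 1)) => y.
have B0 : 0 <= ln (Num.max M 1) by rewrite ln_ge0// le_max lexx orbT.
have [yM|My] := leP (expR y) (Num.max M 1).
  have : y <= ln (Num.max M 1).
    by rewrite -[leLHS]expRK ler_ln ?posrE ?expR_gt0// lt_max ltr01 orbT.
  have := mulr_ge0 (ltW e0) (s0 y); lra.
have /HM/= : M < expR y by apply: le_lt_trans My; rewrite le_max lexx.
rewrite expRK (ger0_norm (s0 y)); have := ler_norm y; lra.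
Qed.

Lemma W0_weight_function sigma : W0 sigma -> weight_function sigma.
Proof.
move=> ws; have s0 y : 0 <= sigma (expR y) by apply: (W0_ge0 ws); exact: expR_ge0.
split=> // x x0; have x1 : 0 < x + 1 by rewrite ltr_wpDl.
(* With this factor x y costs at most sigma(e^y) plus a constant, and x = 0 is covered too. *)
have [|B HB] := @W0_lnE sigma (x + 1)^-1 ws; first by rewrite invr_gt0.
exists (x * B) => y; have := ler_wpM2l x0 (HB y).
suff : x * ((x + 1)^-1 * sigma (expR y)) <= sigma (expR y) by lra.
rewrite mulrA ler_piMl// ler_pdivrMr// mul1r lerDl//.
Qed.

(** The slope is the supremum of the left difference quotients at y: convexity bounds it by the
    right ones, and monotonicity makes it nonnegative. *)
Lemma W0_subgradient sigma y : W0 sigma ->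
  exists2 a, 0 <= a & forall z, sigma (expR y) + a * (z - y) <= sigma (expR z).
Proof.
move=> ws; pose phi z := sigma (expR z).
have phi_mono u v : u <= v -> phi u <= phi v.
  move=> uv; apply: (W0_nondecreasing ws); rewrite ?in_itv/= ?andbT ?expR_ge0//.
  by rewrite ler_expR.
have slope z x : z < y -> y < x -> (phi y - phi z) / (y - z) <= (phi x - phi y) / (x - y).
  move=> zy yx; have zx := lt_trans zy yx.
  have t0 : 0 <= (x - y) / (x - z) by rewrite divr_ge0 ?subr_ge0 ?ltW.
  have t1 : (x - y) / (x - z) <= 1.
    by rewrite ler_pdivrMr ?subr_gt0// mul1r lerB// ltW.
  (* Here y is the convex combination of z and x with weight (x - y) / (x - z) on z. *)
  have := W0_convex ws (Itv01 t0 t1) (mem_set (I : [set: R^o] z)) (mem_set (I : [set: R^o] x)).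
  have -> : conv (Itv01 t0 t1) (z : convex_lmodType R^o) x = y.
    apply: (etrans (convRE _ _ _)); rewrite /= /unstable.onem; field.
    by rewrite subr_eq0 gt_eqF.
  rewrite convRE /= /unstable.onem -!/(phi _) => cvx.
  rewrite ler_pdivrMr ?subr_gt0// mulrAC ler_pdivlMr ?subr_gt0//.
  have xz0 : 0 < x - z by rewrite subr_gt0.
  have := ler_wpM2r (ltW xz0) cvx.
  rewrite mulrDl mulrAC divfK ?gt_eqF// [_ * phi x * _]mulrAC [(1 - _) * (x - z)]mulrBl mul1r divfK ?gt_eqF//.
  lra.
pose S := [set (phi y - phi z) / (y - z) | z in [set z | z < y]].
have S_ub x : y < x -> ubound S ((phi x - phi y) / (x - y)).
  by move=> yx _ [z /= zy <-]; exact: slope.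
have S_ne : S !=set0.
  by exists ((phi y - phi (y - 1)) / (y - (y - 1))), (y - 1) => //=; rewrite ltrBlDr ltrDl.
have S_hub : has_ubound S.
  by eexists; apply: (S_ub (y + 1)); rewrite ltrDl.
exists (sup S).
  apply: (@le_trans _ _ ((phi y - phi (y - 1)) / (y - (y - 1)))).
    by rewrite divr_ge0// subr_ge0 ?phi_mono// gerBl.
  by apply: ub_le_sup => //; exists (y - 1) => //=; rewrite ltrBlDr ltrDl.
move=> z; have [->|/lt_total/orP[zy|yz]] := eqVneq z y; first by rewrite subrr mulr0 addr0.
  have : (phi y - phi z) / (y - z) <= sup S by apply: ub_le_sup => //; exists z.
  by rewrite ler_pdivrMr ?subr_gt0// /phi; lra.
have : sup S <= (phi z - phi y) / (z - y) by apply: ge_sup => //; exact: S_ub.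
by rewrite ler_pdivlMr ?subr_gt0// /phi; lra.
Qed.

(** The bound B, with the term p = 0 from below, makes the extended supremum finite, so [fine] loses
    nothing. *)
Lemma assoc_weight_bounds (M : nat -> R) y B : (forall p, 0 < M p) ->
  (forall p, p%:R * y - ln (M p) <= B) ->
  (forall p, p%:R * y - ln (M p) <= assoc_weight M (expR y)) /\
  assoc_weight M (expR y) <= B.
Proof.
move=> M0 HB; rewrite /assoc_weight.
have E p : lne (expR y ^+ p / M p)%:E = (p%:R * y - ln (M p))%:E.
  rewrite lne_EFin ?divr_gt0 ?exprn_gt0 ?expR_gt0// ln_div ?posrE ?exprn_gt0 ?expR_gt0//.
  by rewrite -expRM_natl expRK.
set s := ereal_sup _.
have ge p : ((p%:R * y - ln (M p))%:E <= s)%E.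
  by apply: ereal_sup_ubound; exists p; rewrite // E.
have le : (s <= B%:E)%E by apply: ge_ereal_sup => _ [p _ <-]; rewrite E lee_fin.
have sE : s = (fine s)%:E.
  by rewrite fineK// fin_numElt (lt_le_trans (ltNyr _) (ge 0%N)) (le_lt_trans le (ltry _)).
by split=> [p|]; rewrite -lee_fin -sE.
Qed.

Lemma assoc_weight_ge0 (M : nat -> R) y : (forall p, 0 < M p) -> M 0%N = 1 ->
  0 <= assoc_weight M (expR y).
Proof.
move=> M0 M1; rewrite /assoc_weight fine_ge0//; apply: ereal_sup_ubound.
by exists 0%N => //; rewrite expr0 M1 divr1 lne1.
Qed.

Lemma weight_matrix0 sigma l : W0 sigma -> 0 < l -> weight_matrix sigma l 0 = 1.
Proof.
move=> ws l0; have ww := W0_weight_function ws.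
suff : ln (weight_matrix sigma l 0) = 0.
  by move=> /(congr1 expR); rewrite lnK ?posrE ?weight_matrix_gt0// expR0.
apply/le_anti/andP; split.
  apply: ln_weight_matrix_le => // y; rewrite mul0r sub0r oppr_le0 divr_ge0 ?(ltW l0)//.
  by case: ww => ->.
have := ln_weight_matrix_ge 0 0 ww l0.
by rewrite mul0r expR0 (W0_zero ws) ?ler01 ?lexx// mul0r subrr.
Qed.

Lemma assoc_weight_matrix_wle sigma l : W0 sigma -> 0 < l ->
  wle (assoc_weight (weight_matrix sigma l)) sigma /\
  wle sigma (assoc_weight (weight_matrix sigma l)).
Proof.
move=> ws l0; have ww := W0_weight_function ws.
have ub y p : p%:R * y - ln (weight_matrix sigma l p) <= sigma (expR y) / l.
  rewrite lerBlDr -lerBlDl; exact: ln_weight_matrix_ge.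
have bounds y := assoc_weight_bounds (@weight_matrix_gt0 _ sigma l) (ub y).
split; first by exists l^-1, 0; split=> [|y]; rewrite ?invr_gt0// addr0 mulrC; case: (bounds y).
(* Rounding the slope will cost y; this choice bounds y by half of sigma(e^y) / l plus a
   constant. *)
have [|B HB] := @W0_lnE sigma (2 * l)^-1 ws; first by rewrite invr_gt0 mulr_gt0.
exists (2 * l), (2 * l * `|B|); split => [|y]; first by rewrite mulr_gt0.
have w0 : 0 <= assoc_weight (weight_matrix sigma l) (expR y).
  by apply: assoc_weight_ge0 => [p|]; [exact: weight_matrix_gt0|exact: weight_matrix0].
have B0 := ler_norm B; have nB0 := normr_ge0 B.
have [y0|/ltW y0] := leP y 0.
  have -> : sigma (expR y) = 0.
    by apply: (W0_zero ws); rewrite expR_ge0 expR_le1.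
  by rewrite addr_ge0 ?mulr_ge0 ?(ltW l0).
have [a a0 sub] := W0_subgradient y ws.
have /andP[pa ap] := truncn_itv (divr_ge0 a0 (ltW l0)).
move: pa ap; set p := Num.truncn _ => pa ap.
(* Since p l <= a, the supporting line at y bounds every z >= 0; for z < 0 the line at 0, where
   sigma(1) = 0, suffices. *)
have lp : ln (weight_matrix sigma l p) <= (a * y - sigma (expR y)) / l.
  apply: ln_weight_matrix_le => // z.
  have s0 u : 0 <= sigma (expR u) by case: ww => ->.
  rewrite ler_pdivlMr// mulrBl divfK ?gt_eqF//.
  move: pa; rewrite ler_pdivlMr// => pa.
  have [z0|/ltW z0] := leP 0 z.
    have := ler_wpM2r z0 pa; have := sub z; lra.
  have s1 : sigma 1 = 0 by apply: (W0_zero ws); rewrite ler01 lexx.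
  have := sub 0; rewrite expR0 s1.
  have := mulr_ge0_le0 (mulr_ge0 (ler0n R p) (ltW l0)) z0; have := s0 z; lra.
have [/(_ p) + _] := bounds y; have := ler_wpM2r y0 (ltW ap).
have := HB y; move: lp; rewrite -natr1.
set q := a / l; set u := sigma (expR y) / l.
have -> : (a * y - sigma (expR y)) / l = q * y - u by rewrite mulrBl /q /u mulrAC.
have -> : sigma (expR y) = u * l by rewrite divfK ?gt_eqF.
have -> : (2 * l)^-1 * (u * l) = u / 2 by field; rewrite gt_eqF.
move=> lp yB qy yw.
(* From a / l < p + 1 follows that u is at most the associated weight plus y, and y <= u / 2 + B. *)
suff : u <= 2 * assoc_weight (weight_matrix sigma l) (expR y) + 2 * `|B|.
  by move=> /(ler_wpM2r (ltW l0)); lra.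
lra.
Qed.

(** Exponentiated with t = e^z: the single term t^n / n! of the exponential series is at most
    e^t. *)
Lemma natr_le_exp n z : n%:R * z - ln n`!%:R <= expR z :> R.
Proof.
case: n => [|n]; first by rewrite mul0r fact0 ln1 subrr expR_ge0.
have f0 : 0 < (n.+1)`!%:R :> R by rewrite ltr0n fact_gt0.
rewrite -ler_expR expRB lnK ?posrE// expRM_natl.
have := expR_ge1Dxn n (expR_ge0 z); lra.
Qed.

Lemma gevrey_gt0 alpha p : 0 < gevrey alpha p.
Proof. by rewrite /gevrey powR_gt0// ltr0n fact_gt0. Qed.

Lemma ln_gevrey alpha p : ln (gevrey alpha p) = alpha * ln p`!%:R.
Proof. by rewrite /gevrey ln_powR. Qed.

Lemma ln_gevrey_ge alpha y p : 0 < alpha ->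
  p%:R * y - ln (gevrey alpha p) <= alpha * expR (y / alpha).
Proof.
move=> a0; have /(ler_wpM2l (ltW a0)) := natr_le_exp p (y / alpha).
rewrite ln_gevrey mulrBr (_ : alpha * (p%:R * (y / alpha)) = p%:R * y) //.
by field; rewrite gt_eqF.
Qed.

Lemma ln_fact_le p x : p%:R <= expR x -> ln p`!%:R <= p%:R * x :> R.
Proof.
move=> px; rewrite -[leRHS]expRK ler_ln ?posrE ?expR_gt0 ?ltr0n ?fact_gt0//.
rewrite expRM_natl; apply: (@le_trans _ _ (p%:R ^+ p)); last by rewrite lerXn2r ?nnegrE ?expR_ge0.
rewrite -natrX ler_nat.
suff /(_ p p (leqnn p)) : forall m n, (n <= m)%N -> (n`! <= m ^ n)%N by [].
by move=> m; elim=> // n IH nm; rewrite factS expnS leq_mul// IH// ltnW.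
Qed.

Lemma gevrey_weight_wle alpha : 0 < alpha ->
  wle (assoc_weight (gevrey alpha)) (fun t => t `^ alpha^-1) /\
  wle (fun t => t `^ alpha^-1) (assoc_weight (gevrey alpha)).
Proof.
move=> a0.
have ub y p := ln_gevrey_ge y p a0.
have bounds y := assoc_weight_bounds (@gevrey_gt0 alpha) (ub y).
split; first by exists alpha, 0; split=> // y; rewrite addr0 -expRM; case: (bounds y).
exists (expR 1 / alpha), (expR 1); split; first by rewrite divr_gt0 ?expR_gt0.
move=> y; rewrite -expRM; set z := y / alpha.
(* For p the integer part of e^(z - 1), p! <= p^p <= e^(p (z - 1)), so the term of index p is at
   least alpha p. *)
have /andP[pz zp] := truncn_itv (expR_ge0 (z - 1)).
move: pz zp; set p := Num.truncn _ => pz zp.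
have fp : ln p`!%:R <= p%:R * (z - 1).
  exact: ln_fact_le.
have [/(_ p) + _] := bounds y; rewrite ln_gevrey => yp.
have -> : expR z = expR 1 * expR (z - 1) by rewrite -expRD addrC subrK.
suff : expR (z - 1) <= assoc_weight (gevrey alpha) (expR y) / alpha + 1.
  by move=> /(ler_wpM2l (expR_ge0 1)); lra.
apply: ltW; apply: (lt_le_trans zp); rewrite -natr1 lerD2r ler_pdivlMr//.
have := ler_wpM2l (ltW a0) fp.
have yE : y = z * alpha by rewrite divfK ?gt_eqF.
by move: yp; rewrite {1}yE; lra.
Qed.

Lemma powR_weight_function alpha : 0 < alpha ->
  weight_function (fun t => t `^ alpha^-1).
Proof.
move=> a0; have [le1 le2] := gevrey_weight_wle a0.
split=> [y|x x0]; first exact: powR_ge0.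
(* As x alpha < n + 1, the term of order n + 1 of the exponential series controls x y for y >= 0. *)
have /andP[_ xn] := truncn_itv (mulr_ge0 x0 (ltW a0)).
move: xn; set n := Num.truncn _ => xn.
exists (ln n.+1`!%:R) => y; rewrite -expRM.
have e0 := expR_ge0 (y / alpha).
have [y0|/ltW y0] := leP 0 y; last first.
  have : 0 <= ln n.+1`!%:R :> R by rewrite ln_ge0// ler1n fact_gt0.
  have := mulr_ge0_le0 x0 y0; lra.
have := natr_le_exp n.+1 (y / alpha); have := ler_wpM2r (divr_ge0 y0 (ltW a0)) (ltW xn).
by rewrite -mulrA [alpha * _]mulrC divfK ?gt_eqF//; lra.
Qed.

(** The geometric bases on both sides are multiples of l^alpha, so varying l absorbs any factor
    h^p. *)
Lemma weight_matrix_powR alpha l p : 0 < alpha -> 0 < l ->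
  expR (-1) * (l `^ alpha / expR 1) ^+ p * gevrey alpha p
    <= weight_matrix (fun t => t `^ alpha^-1) l p
    <= ((l * alpha) `^ alpha) ^+ p * gevrey alpha p.
Proof.
move=> a0 l0; have ww := powR_weight_function a0.
have g0 := gevrey_gt0 alpha p.
have e1 := @expR_gt0 R 1.
have la0 : 0 < l `^ alpha by rewrite powR_gt0.
have la1 : 0 < (l * alpha) `^ alpha by rewrite powR_gt0// mulr_gt0.
apply/andP; split.
  rewrite -ler_ln ?posrE ?weight_matrix_gt0 ?mulr_gt0 ?expR_gt0 ?exprn_gt0 ?divr_gt0//.
  rewrite !lnM ?posrE ?mulr_gt0 ?expR_gt0 ?exprn_gt0 ?divr_gt0 ?invr_gt0//.
  rewrite lnXn ?divr_gt0// ln_div ?posrE// (expRK (-1)) (expRK 1) ln_powR ln_gevrey.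
  have p0 : 0 < p%:R + 1 :> R by rewrite ltr_wpDl.
  (* At this test point e^(y / alpha) / l = p + 1; the shift by 1 keeps the logarithm meaningful at
     p = 0. *)
  have := ln_weight_matrix_ge (alpha * (ln (p%:R + 1) + ln l)) p ww l0.
  rewrite -expRM [alpha * _]mulrC mulfK ?gt_eqF// expRD !lnK ?posrE//.
  rewrite mulfK ?gt_eqF//.
  have : ln p`!%:R <= p%:R * ln (p%:R + 1) :> R.
    by apply: ln_fact_le; rewrite lnK ?posrE// lerDl.
  move=> /(ler_wpM2l (ltW a0)); rewrite -mulr_natl; lra.
rewrite -ler_ln ?posrE ?weight_matrix_gt0 ?mulr_gt0 ?exprn_gt0//.
rewrite lnM ?posrE ?exprn_gt0// lnXn// ln_powR ln_gevrey.
apply: ln_weight_matrix_le => // y; rewrite -expRM.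
(* The shift makes alpha times the exponential equal to e^(y / alpha) / l. *)
have := natr_le_exp p (y / alpha - ln (l * alpha)).
rewrite expRB lnK ?posrE ?mulr_gt0// => /(ler_wpM2l (ltW a0)).
have -> : alpha * (expR (y / alpha) / (l * alpha)) = expR (y / alpha) / l.
  by field; rewrite !gt_eqF.
have -> : alpha * (p%:R * (y / alpha - ln (l * alpha)) - ln p`!%:R) =
    p%:R * y - p%:R * (alpha * ln (l * alpha)) - alpha * ln p`!%:R.
  by field; rewrite gt_eqF.
by rewrite -mulr_natl; lra.
Qed.

End Growth.

(** * Log-convex sequences and the associated weight of a product *)

Section LogConvex.
Context {R : realType}.
Set Implicit Arguments.
Unset Strict Implicit.
Implicit Types (sigma : R -> R) (m n : nat -> R) (M N : nat -> R) (a x y z alpha : R).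

Definition log_convex M : Prop :=
  forall p, ln (M p.+1) - ln (M p) <= ln (M p.+2) - ln (M p.+1).

Lemma log_convex_argmax M a p : log_convex M ->
  a <= ln (M p.+1) - ln (M p) ->
  (forall q, p = q.+1 -> ln (M q.+1) - ln (M q) <= a) ->
  forall q, q%:R * a - ln (M q) <= p%:R * a - ln (M p).
Proof.
move=> cM ap pa.
have mono q k : ln (M q.+1) - ln (M q) <= ln (M (q + k).+1) - ln (M (q + k)%N).
  elim: k => [|k]; rewrite ?addn0// addnS => /le_trans; apply; exact: cM.
have up k : (p + k)%:R * a - ln (M (p + k)%N) <= p%:R * a - ln (M p).
  elim: k => [|k]; rewrite ?addn0// addnS -natr1.
  have := mono p k; lra.
have dn k q : (q + k)%N = p -> q%:R * a - ln (M q) <= p%:R * a - ln (M p).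
  elim: k q => [|k IH] q; first by rewrite addn0 => ->.
  rewrite addnS -addSn => qp; have := IH _ qp; rewrite -natr1.
  have := pa (q + k)%N; rewrite -qp addSn => /(_ erefl).
  have := mono q k; lra.
move=> q; have [pq|/ltnW qp] := leqP p q; first by have := up (q - p)%N; rewrite subnKC.
by apply: (dn (p - q)%N); rewrite subnKC.
Qed.

Lemma inf_conv_assoc_weight M N y :
  (forall p, 0 < M p) -> (forall p, 0 < N p) -> M 0%N = 1 -> N 0%N = 1 ->
  (forall y, exists B, forall p, p%:R * y - ln (M p) <= B) ->
  (forall y, exists B, forall p, p%:R * y - ln (N p) <= B) ->
  log_convex M -> log_convex N ->
  (forall B, exists p, B <= ln (N p.+1) - ln (N p)) ->
  assoc_weight (seq_mul M N) (expR y)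
    = inf_conv (assoc_weight M) (assoc_weight N) (expR y).
Proof.
move=> M0 N0 M1 N1 bM bN cM cN dN.
have MN0 p : 0 < seq_mul M N p by rewrite mulr_gt0.
have lnMN p : ln (seq_mul M N p) = ln (M p) + ln (N p) by rewrite lnM ?posrE.
have geM z : forall p, p%:R * z - ln (M p) <= assoc_weight M (expR z).
  by have [B /(assoc_weight_bounds M0)[]] := bM z.
have geN z : forall p, p%:R * z - ln (N p) <= assoc_weight N (expR z).
  by have [B /(assoc_weight_bounds N0)[]] := bN z.
have ub a p : p%:R * y - ln (seq_mul M N p) <=
    assoc_weight M (expR a) + assoc_weight N (expR (y - a)).
  rewrite lnMN; have := geM a p; have := geN (y - a) p; lra.
apply/le_anti/andP; split.
  apply: inf_conv_ge => a; exact: (assoc_weight_bounds MN0 (ub a)).2.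
(* The least such p is a maximal index for the product at y; it exists because the increments of M
   are bounded below and those of N are unbounded. *)
pose P p := y < (ln (M p.+1) - ln (M p)) + (ln (N p.+1) - ln (N p)).
have exP : exists p, P p.
  have [p pB] := dN (y - (ln (M 1%N) - ln (M 0%N)) + 1); exists p; rewrite /P.
  have : ln (M 1%N) - ln (M 0%N) <= ln (M p.+1) - ln (M p).
    by elim: p {pB} => // p /le_trans; apply.
  lra.
have [p Pp pmin] := ex_minnP exP.
have prevP q : p = q.+1 ->
    (ln (M q.+1) - ln (M q)) + (ln (N q.+1) - ln (N q)) <= y.
  by move=> pq; rewrite leNgt; apply/negP => /pmin; rewrite pq ltnn.
(* Splitting y as a + (y - a) so that p is maximal for M at a and for N at y - a. For p > 0 the
   least admissible a is taken; log-convexity and minimality of p make it admissible. *)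
have [a [aM aN Ma Na]] : exists a, [/\ a <= ln (M p.+1) - ln (M p),
    y - a <= ln (N p.+1) - ln (N p),
    forall q, p = q.+1 -> ln (M q.+1) - ln (M q) <= a &
    forall q, p = q.+1 -> ln (N q.+1) - ln (N q) <= y - a].
  move: Pp; rewrite /P; case: p pmin prevP => [|p] _ prevP Pp.
    by exists (y - (ln (N 1%N) - ln (N 0%N))); split=> //; lra.
  have := prevP p erefl; have := cM p; have := cN p => cNp cMp py.
  exists (Num.max (ln (M p.+1) - ln (M p)) (y - (ln (N p.+2) - ln (N p.+1)))).
  split=> [||q [<-]|q [<-]].
  - by rewrite ge_max; apply/andP; split; lra.
  - by rewrite lerBlDr -lerBlDl le_max; apply/orP; right; lra.
  - by rewrite le_max lexx.
  - by rewrite lerBrDr -lerBrDl ge_max; apply/andP; split; lra.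
apply: le_trans (inf_conv_le y a _ _) _; [| |].
- by move=> z; exact: assoc_weight_ge0.
- by move=> z; exact: assoc_weight_ge0.
have leM := (assoc_weight_bounds M0 (log_convex_argmax cM aM Ma)).2.
have leN := (assoc_weight_bounds N0 (log_convex_argmax cN aN Na)).2.
have := (assoc_weight_bounds MN0 (ub a)).1 p; rewrite lnMN.
move: leM leN; lra.
Qed.

(** The logarithm is a supremum of functions affine in p, hence midpoint convex. *)
Lemma log_convex_weight_matrix sigma l : weight_function sigma -> 0 < l ->
  log_convex (weight_matrix sigma l).
Proof.
move=> ws l0 p.
suff : 2 * ln (weight_matrix sigma l p.+1) <=
    ln (weight_matrix sigma l p) + ln (weight_matrix sigma l p.+2) by lra.
rewrite mulrC -ler_pdivlMr//; apply: ln_weight_matrix_le => // y.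
rewrite ler_pdivlMr//.
have := ln_weight_matrix_ge y p ws l0; have := ln_weight_matrix_ge y p.+2 ws l0.
rewrite -[p.+2]addn2 -[p.+1]addn1 !natrD; lra.
Qed.

Lemma ln_gevrey_step alpha p :
  ln (gevrey alpha p.+1) - ln (gevrey alpha p) = alpha * ln p.+1%:R.
Proof.
rewrite !ln_gevrey factS natrM lnM ?posrE ?ltr0n ?fact_gt0//; lra.
Qed.

Lemma log_convex_gevrey alpha : 0 < alpha -> log_convex (gevrey alpha).
Proof.
move=> a0 p; rewrite !ln_gevrey_step ler_wpM2l ?(ltW a0)//.
by rewrite ler_ln ?posrE ?ltr0n// ler_nat.
Qed.

Lemma gevrey_step_unbounded alpha : 0 < alpha ->
  forall B, exists p, B <= ln (gevrey alpha p.+1) - ln (gevrey alpha p).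
Proof.
move=> a0 B; exists (Num.truncn (expR (B / alpha))).
rewrite ln_gevrey_step mulrC -ler_pdivrMr// -[leLHS]expRK ler_ln ?posrE ?expR_gt0 ?ltr0n//.
exact: ltW (truncnS_gt _).
Qed.

End LogConvex.

(** * Identification of the matrix space and the chain of equalities *)

Section Main.
Context {R : realType}.
Set Implicit Arguments.
Unset Strict Implicit.
Implicit Types (sigma : R -> R) (alpha l y : R).

Lemma space_matrix_inf_conv F br sigma alpha : weight_function sigma -> 0 < alpha ->
  space_matrix F br (fun k => seq_mul (weight_matrix sigma k) (gevrey alpha))
  = space_function F br (inf_conv sigma (fun t => t `^ alpha^-1)).
Proof.
move=> ws a0; have wt := powR_weight_function a0.
have wm0 w k p : 0 <= weight_matrix w k p := ltW (weight_matrix_gt0 w k p).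
have gm0 p : 0 <= gevrey alpha p := ltW (gevrey_gt0 alpha p).
have wE k p : 0 < k -> weight_matrix (inf_conv sigma (fun t => t `^ alpha^-1)) k p
    = weight_matrix sigma k p * weight_matrix (fun t => t `^ alpha^-1) k p.
  move=> k0; rewrite /weight_matrix -expRD -mulrDr.
  by rewrite phi_star_inf_conv // mulr_ge0// ltW.
have lower k k' h : 0 < k -> k <= k' -> h <= k' `^ alpha / expR 1 -> 0 < h ->
    exists2 C, 0 < C & forall p, h ^+ p * seq_mul (weight_matrix sigma k) (gevrey alpha) p
      <= C * weight_matrix (inf_conv sigma (fun t => t `^ alpha^-1)) k' p.
  move=> k0 kk' hk' h0; have k'0 := lt_le_trans k0 kk'.
  exists (expR 1) => [|p]; first exact: expR_gt0.
  have /andP[+ _] := weight_matrix_powR p a0 k'0.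
  rewrite expRN -mulrA ler_pdivrMl ?expR_gt0// => le.
  rewrite wE// [leRHS]mulrCA /seq_mul [leLHS]mulrCA.
  apply: ler_pM; first exact: wm0.
  - by rewrite mulr_ge0 ?exprn_ge0 ?(ltW h0) ?gm0.
  - exact: weight_matrix_mono.
  apply: le_trans le; rewrite ler_wpM2r ?gm0// lerXn2r ?nnegrE ?(ltW h0)//.
  by rewrite divr_ge0 ?powR_ge0 ?expR_ge0.
have upper k k' h : 0 < k -> k <= k' -> (k * alpha) `^ alpha <= h ->
    exists2 C, 0 < C & forall p, weight_matrix (inf_conv sigma (fun t => t `^ alpha^-1)) k p
      <= C * (h ^+ p * seq_mul (weight_matrix sigma k') (gevrey alpha) p).
  move=> k0 kk' kh; exists 1 => // p; rewrite mul1r wE//.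
  have /andP[_ le] := weight_matrix_powR p a0 k0.
  rewrite /seq_mul [leRHS]mulrCA.
  apply: ler_pM; [exact: wm0|exact: wm0|exact: weight_matrix_mono|].
  apply: (le_trans le); rewrite ler_wpM2r ?gm0// lerXn2r ?nnegrE ?powR_ge0//.
  exact: le_trans (powR_ge0 _ _) kh.
have powK x : 0 <= x -> (x `^ alpha^-1) `^ alpha = x.
  by move=> x0; rewrite -powRrM mulVf ?gt_eqF// powRr1.
apply: weighted_eq => [[k h] p|k p|].
- by rewrite /= mulr_gt0 ?exprn_gt0 ?mulr_gt0 ?weight_matrix_gt0 ?gevrey_gt0.
- exact: weight_matrix_gt0.
split=> [[k h]|k|k|[k h]].
(* Roumieu: k' is enlarged until k'^alpha / e reaches the given h. *)
- pose k' := Num.max k%:num ((h%:num * expR 1) `^ alpha^-1).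
  have kk' : k%:num <= k' by rewrite le_max lexx.
  have k'0 : 0 < k' by apply: lt_le_trans kk'.
  exists (PosNum k'0); apply: lower => //=.
  rewrite ler_pdivlMr ?expR_gt0// -[leLHS]powK ?mulr_ge0 ?expR_ge0//.
  by rewrite ge0_ler_powR ?nnegrE ?powR_ge0 ?(ltW a0) ?(ltW k'0)// le_max lexx orbT.
- have h0 : 0 < (k%:num * alpha) `^ alpha by rewrite powR_gt0// mulr_gt0.
  by exists (k, PosNum h0); exact: upper.
- have h0 : 0 < k%:num `^ alpha / expR 1 by rewrite divr_gt0 ?powR_gt0 ?expR_gt0.
  by exists (k, PosNum h0); exact: lower.
(* Beurling: k' is shrunk until (k' alpha)^alpha drops below the given h. *)
- pose k' := Num.min k%:num (h%:num `^ alpha^-1 / alpha).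
  have k'0 : 0 < k' by rewrite lt_min divr_gt0 ?powR_gt0 ?andbT.
  exists (PosNum k'0); apply: upper => //=; first by rewrite ge_min lexx.
  rewrite -[leRHS]powK//.
  rewrite ge0_ler_powR ?nnegrE ?powR_ge0 ?mulr_ge0 ?(ltW a0) ?(ltW k'0)//.
  by rewrite -ler_pdivlMr// ge_min lexx orbT.
Qed.

(** The substitution s = u^(-alpha) turns (t / s)^(1 / alpha) into t^(1 / alpha) u and maps the
    positive half-line onto itself. *)
Lemma powsub_lower_conjE sigma alpha : 0 < alpha ->
  forall y, inf_conv sigma (fun t => t `^ alpha^-1) (expR y)
    = powsub (lower_conj (powsub (invsub sigma) alpha)) alpha^-1 (expR y).
Proof.
move=> a0 y; rewrite /inf_conv /powsub /lower_conj /invsub; congr inf.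
apply/seteqP; split=> _ [s /= s0 <-].
  exists (s `^ (- alpha^-1)) => /=; first exact: powR_gt0.
  rewrite -powRrM mulNr mulVf ?gt_eqF// powRN powRr1 ?(ltW s0)// invrK.
  rewrite powRM ?expR_ge0 ?invr_ge0 ?(ltW s0)//.
  by rewrite -[s^-1]powR_inv1 ?(ltW s0)// -powRrM mulN1r powRN.
exists ((s `^ alpha)^-1) => /=; first by rewrite invr_gt0 powR_gt0.
by rewrite invrK powRM ?expR_ge0 ?powR_ge0// -powRrM mulfV ?gt_eqF// powRr1 // ltW.
Qed.

End Main.

Theorem corollary3p3 (R : realType) (sigma : R -> R) (hsigma : W0 sigma)
    (alpha : R) (halpha : 0 < alpha) (l : R) (hl : 0 < l)
    (F : object_class R) (br : bracket) :
  [/\ space_matrix F br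
        (fun k => seq_mul (weight_matrix sigma k) (gevrey alpha))
      = space_function F br
          (assoc_weight (seq_mul (weight_matrix sigma l) (gevrey alpha))),
      space_function F br
        (assoc_weight (seq_mul (weight_matrix sigma l) (gevrey alpha)))
      = space_function F br
          (inf_conv (assoc_weight (weight_matrix sigma l))
                    (assoc_weight (gevrey alpha))),
      space_function F br
        (inf_conv (assoc_weight (weight_matrix sigma l))
                  (assoc_weight (gevrey alpha)))
      = space_function F br (inf_conv sigma (assoc_weight (gevrey alpha))),
      space_function F br (inf_conv sigma (assoc_weight (gevrey alpha)))
      = space_function F br (inf_conv sigma (fun t => t `^ alpha^-1)) &
      space_function F br (inf_conv sigma (fun t => t `^ alpha^-1))
      = space_function F br
          (powsub (lower_conj (powsub (invsub sigma) alpha)) alpha^-1)].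
Proof.
have ws := W0_weight_function hsigma.
have [s0 _] := ws.
have wt := powR_weight_function halpha.
have [t0 _] := wt.
have M0 := @weight_matrix_gt0 R sigma l.
have G0 := gevrey_gt0 alpha.
have M1 := weight_matrix0 hsigma hl.
have G1 : gevrey alpha 0 = 1 by rewrite /gevrey fact0 powR1.
have oM0 y : 0 <= assoc_weight (weight_matrix sigma l) (expR y) by exact: assoc_weight_ge0.
have oG0 y : 0 <= assoc_weight (gevrey alpha) (expR y) by exact: assoc_weight_ge0.
have [oMs soM] := assoc_weight_matrix_wle hsigma hl.
have [oGt toG] := gevrey_weight_wle halpha.
have woM := wle_weight_function soM ws oM0.
have woG := wle_weight_function toG wt oG0.
have refl (w : R -> R) : wle w w by exists 1, 0; split=> // y; rewrite mul1r addr0.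
(* Such f and g may differ at 0 and so fall into different branches of [phi_star]; [wle] with
   constants 1 and 0 sees positive arguments only. *)
have eq_sp f g : weight_function f -> (forall y, f (expR y) = g (expR y)) ->
    space_function F br f = space_function F br g.
  move=> wf fg; have [gf fg'] : wle g f /\ wle f g.
    by split; exists 1, 0; split=> // y; rewrite mul1r addr0 fg.
  apply: wle_space_function => //; apply: (wle_weight_function fg' wf) => y.
  by rewrite -fg; case: wf => ->.
have E45 : space_function F br (inf_conv sigma (assoc_weight (gevrey alpha)))
      = space_function F br (inf_conv sigma (fun t => t `^ alpha^-1)).
  apply: wle_space_function.
  - exact: inf_conv_weight_function.
  - exact: inf_conv_weight_function.
  - exact: inf_conv_wle.
  - exact: inf_conv_wle.
have E34 : space_function F br
        (inf_conv (assoc_weight (weight_matrix sigma l))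
                  (assoc_weight (gevrey alpha)))
      = space_function F br (inf_conv sigma (assoc_weight (gevrey alpha))).
  apply: wle_space_function.
  - exact: inf_conv_weight_function.
  - exact: inf_conv_weight_function.
  - exact: inf_conv_wle.
  - exact: inf_conv_wle.
have E23 : space_function F br
        (assoc_weight (seq_mul (weight_matrix sigma l) (gevrey alpha)))
      = space_function F br
          (inf_conv (assoc_weight (weight_matrix sigma l))
                    (assoc_weight (gevrey alpha))).
  apply/esym/eq_sp; first exact: inf_conv_weight_function.
  move=> y; apply: esym; apply: (inf_conv_assoc_weight _ M0 G0 M1 G1).
  - move=> z; exists (sigma (expR z) / l) => p.
    by rewrite lerBlDr -lerBlDl; exact: ln_weight_matrix_ge.
  - move=> z; exists (alpha * expR (z / alpha)) => p; exact: ln_gevrey_ge.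
  - exact: log_convex_weight_matrix.
  - exact: log_convex_gevrey.
  - exact: gevrey_step_unbounded.
split; [|exact: E23|exact: E34|exact: E45|].
(* The matrix space is tied to the convolution with t^(1 / alpha), and the chain is followed back to
   it. *)
- by rewrite E23 E34 E45; exact: space_matrix_inf_conv.
- by apply: eq_sp; [exact: inf_conv_weight_function|exact: powsub_lower_conjE].
Qed.
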